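(* Let $\Theta=(\theta^1,\theta^2,\theta^3)$ be a real $1\times3$ matrix (a single linear form in three variables) with $1,\theta^1,\theta^2,\theta^3$ linearly independent over $\mathbb Z$. Then $\beta(\Theta)\geqslant\alpha(\Theta)\,g_2(\alpha(\Theta))$, where for $\alpha\geqslant3$ $$g_2(\alpha)=\sqrt{\alpha+\frac{1}{\alpha^2}-\frac74}+\frac1\alpha-\frac12.$$
   Context: $\|\cdot\|$ = distance to nearest integer. Jarník's function: $\psi_\Theta(t)=\min_{\mathbf x\in\mathbb Z^3,\,0<\max_i|x_i|\leqslant t}\|\theta^1x_1+\theta^2x_2+\theta^3x_3\|$. $\alpha(\Theta)$ is the supremum of $\gamma$ with $\limsup_{t\to+\infty}t^\gamma\psi_\Theta(t)<+\infty$, and $\beta(\Theta)$ is the supremum of $\gamma$ with $\liminf_{t\to+\infty}t^\gamma\psi_\Theta(t)<+\infty$. (One always has $\alpha(\Theta)\geqslant3$.) *)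

(* Defs.v *)
(* MathComp-Analysis *)
From HB Require Import structures.
From mathcomp Require Import all_boot all_order all_algebra.
From mathcomp Require Import all_classical all_reals all_analysis.

Set Implicit Arguments.
Unset Strict Implicit.
Unset Printing Implicit Defensive.

Import Order.TTheory GRing.Theory Num.Theory.
Import numFieldNormedType.Exports.

Local Open Scope classical_set_scope.
Local Open Scope ring_scope.

Definition dist_int (R : realType) (y : R) : R :=
  inf [set `|y - k%:~R| | k in [set: int]].

Definition linear_form (R : realType) (n : nat) (Theta : 'rV[R]_n)
    (x : 'cV[int]_n) : R :=
  (Theta *m map_mx intr x) 0 0.

Definition lin_indep_int (R : realType) (n : nat) (v : 'rV[R]_n) : Prop :=
  forall c : 'cV[int]_n, linear_form v c = 0 -> c = 0.

Definition height (n : nat) (x : 'cV[int]_n) : int :=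
  \big[Num.max/0]_(i < n) `|x i 0|.

(* For t >= 1 the set below is nonempty and finite, so [inf] is a minimum;
   for t < 1 it is empty and the (irrelevant) value is 0. *)
Definition psi (R : realType) (Theta : 'rV[R]_3) (t : R) : R :=
  inf [set dist_int (linear_form Theta x) | x in
        [set x : 'cV[int]_3 | 0 < height x /\ (height x)%:~R <= t]].

(* The exponents are suprema in the extended reals: either may be +oo. *)
Definition alpha (R : realType) (Theta : 'rV[R]_3) : \bar R :=
  ereal_sup [set gamma%:E | gamma in [set gamma : R |
    (limf_esup (fun t : R => (t `^ gamma * psi Theta t)%:E) (pinfty_nbhs R)
      < +oo)%E]].

Definition beta (R : realType) (Theta : 'rV[R]_3) : \bar R :=
  ereal_sup [set gamma%:E | gamma in [set gamma : R |
    (limf_einf (fun t : R => (t `^ gamma * psi Theta t)%:E) (pinfty_nbhs R)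
      < +oo)%E]].

Definition g2 (R : realType) (a : R) : R :=
  Num.sqrt (a + 1 / a ^+ 2 - 7 / 4) + 1 / a - 1 / 2.

(* [er_map] sends +oo to +oo, which is the limit of [g2] at +oo. *)
Definition g2_ext (R : realType) (a : \bar R) : \bar R := er_map (@g2 R) a.

(* Main.v *)
(** We prove the stronger bound beta >= alpha * g with g the positive root of
    g^2 + g = alpha - 1; for alpha >= 3 one has g2(alpha) <= g.  Let z_k be the
    minimal points of the form L, X_k their heights and L_k = |L(z_k)|, and
    suppose L_k <= X_(k+1)^(-a) and L_k >= X_k^(-b) up to constants, with
    b = a g, so that X_(k+1) <= X_k^g.

    Consecutive minimal points are a lattice basis of the plane they span, and
    L_k X_(k+1) is comparable to an invariant of that plane.  Since it tends
    to 0, the plane changes infinitely often.  Either two successive changes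
    k < l with the same plane <z_(k+1), z_(k+2)> = <z_(l-1), z_l> in between
    produce four independent points z_k, z_(k+1), z_(k+2), z_(l+1) for
    infinitely many k, or all minimal points eventually lie in a fixed
    three-dimensional space.

    In the first case the integer determinant gives
    1 << L_k X_(k+1) X_(k+2) X_(l+1), the plane invariant gives
    L_(k+1) X_(k+2) << L_(l-1) X_l, and taking logarithms, the linear
    combination of these inequalities yields a - 1 <= g + g^2.  In the second
    case 1 << L_k X_(k+1) X_(k+2), which yields even a - 1 <= g. *)
Require Import Defs.
From HB Require Import structures.
From mathcomp Require Import all_boot all_order all_fingroup all_algebra.
From mathcomp Require Import all_classical all_reals all_analysis.
From mathcomp Require Import zify ring lra.

Import Order.TTheory GRing.Theory Num.Theory.
Import numFieldNormedType.Exports.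

Set Implicit Arguments.
Unset Strict Implicit.
Unset Printing Implicit Defensive.

Local Open Scope ring_scope.

(** * Linear algebra: planes spanned by consecutive vectors *)

Definition plane (F : fieldType) (n : nat) (Z : nat -> 'rV[F]_n) (k : nat) :
  'M[F]_n := (Z k + Z k.+1)%MS.

Lemma rank_adds_row (F : fieldType) (m n : nat) (A : 'M[F]_(m, n))
    (v : 'rV[F]_n) :
  ~~ (v <= A)%MS -> \rank (A + v)%MS = (\rank A).+1.
Proof.
move=> vA; apply/eqP; rewrite eqn_leq; apply/andP; split.
  rewrite -(addn1 (\rank A)); apply: leq_trans (mxrank_adds_leqif _ _) _.
  by rewrite leq_add2l rank_leq_row.
rewrite ltn_neqAle mxrankS ?addsmxSl// andbT.
apply: contraNneq vA => /eqP; rewrite mxrank_leqif_sup ?addsmxSl// => h.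
by apply: submx_trans h; rewrite addsmxSr.
Qed.

Lemma rank_sub_eq (F : fieldType) (m1 m2 n : nat) (A : 'M[F]_(m1, n))
    (B : 'M[F]_(m2, n)) :
  (A <= B)%MS -> \rank A = \rank B -> (B <= A)%MS.
Proof. by move=> AB /eqP; rewrite mxrank_leqif_sup. Qed.

(** If the second alternative fails beyond [N], take a plane change [k] there and let [U] be spanned
    by [Z k], [Z k.+1], [Z k.+2]. The first later point outside [U], paired with the last plane
    change before it, would realise the excluded configuration. *)
Lemma plane_dichotomy (F : fieldType) (n : nat) (Z : nat -> 'rV[F]_n) :
  (forall k, \rank (plane Z k) = 2) ->
  (forall N, exists2 k, (N <= k)%N & ~~ (Z k.+2 <= plane Z k)%MS) ->
  (exists (U : 'M[F]_n) (N : nat), \rank U = 3 /\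
     forall j, (N <= j)%N -> (Z j <= U)%MS) \/
  (forall N, exists k l, [/\ (N <= k)%N, (k.+2 <= l)%N,
     ~~ (Z k.+2 <= plane Z k)%MS,
     forall j, (k < j <= l)%N -> (Z j <= plane Z k.+1)%MS &
     ~~ (Z l.+1 <= plane Z k + Z k.+2)%MS]).
Proof.
move=> rk2 chg.
case: (pselect (forall N, exists k l, [/\ (N <= k)%N, (k.+2 <= l)%N,
     ~~ (Z k.+2 <= plane Z k)%MS,
     forall j, (k < j <= l)%N -> (Z j <= plane Z k.+1)%MS &
     ~~ (Z l.+1 <= plane Z k + Z k.+2)%MS])); first by right.
move=> /existsNP[N noN]; left.
have [k Nk kchg] := chg N.
pose U := (plane Z k + Z k.+2)%MS.
have rU : \rank U = 3 by rewrite rank_adds_row// rk2.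
exists U, k.
(* The induction carries the last change [c] before [j]: its three vectors span [U], and all points
   after [c] up to [j] lie in one plane. *)
have inv j : (k.+2 <= j)%N -> (Z j <= U)%MS /\ exists c, [/\ (N <= c)%N, (c.+2 <= j)%N,
    ~~ (Z c.+2 <= plane Z c)%MS, (plane Z c + Z c.+2 == U)%MS &
    forall i, (c < i <= j)%N -> (Z i <= plane Z c.+1)%MS].
  elim: j => // j IH; rewrite leq_eqVlt => /orP[/eqP[<-]|].
    split; first exact: addsmxSr.
    exists k; split => //; first exact/eqmxP.
    move=> i /andP[ki]; rewrite leq_eqVlt ltnS => /orP[/eqP->|ik].
      exact: addsmxSr.
    by rewrite (_ : i = k.+1) ?addsmxSl//; apply/eqP; rewrite eqn_leq ik.
  case: j IH => // j IH; rewrite ltnS => /IH[ZjU [c [Nc cj cchg cU cP]]].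
  have PjP : (plane Z j == plane Z c.+1)%MS.
    have sub : (plane Z j <= plane Z c.+1)%MS.
      by rewrite addsmx_sub !cP ?ltnSn ?leqnSn ?andbT// ltnW.
    by rewrite sub rank_sub_eq// !rk2.
  have cUP : (plane Z c.+1 <= U)%MS.
    rewrite -(eqmxP cU) /plane addsmx_sub addsmxSr andbT.
    by rewrite (submx_trans _ (addsmxSl _ _))// addsmxSr.
  (* If the plane persists, [c] is kept. Otherwise the failure of the second alternative at [c] and
     [j.+1] puts the new point in [U], and [j] becomes the last change. *)
  case: (boolP (Z j.+2 <= plane Z c.+1)%MS) => Zj2.
    split; first exact: submx_trans cUP.
    exists c; split=> //; first exact: leqW.
    move=> i /andP[ci]; rewrite leq_eqVlt => /orP[/eqP->//|ij].
    by apply: cP; rewrite ci.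
  have Zj2U : (Z j.+2 <= U)%MS.
    rewrite -(eqmxP cU); apply: contrapT => /negP nT.
    by apply: noN; exists c, j.+1; split.
  have Zj2P : ~~ (Z j.+2 <= plane Z j)%MS by rewrite (eqmxP PjP).
  split=> //; exists j; split=> //; first by rewrite (leq_trans Nc)// ltnW.
    have sub : (plane Z j + Z j.+2 <= U)%MS.
      by rewrite addsmx_sub Zj2U andbT (eqmxP PjP).
    by rewrite sub rank_sub_eq// rU rank_adds_row ?rk2.
  move=> i /andP[ji]; rewrite leq_eqVlt => /orP[/eqP->|ij].
    exact: addsmxSr.
  by rewrite (_ : i = j.+1) ?addsmxSl//; apply/eqP; rewrite eqn_leq ji andbT.
split=> // j; rewrite leq_eqVlt => /orP[/eqP<-|].
  by rewrite (submx_trans _ (addsmxSl _ _))// addsmxSl.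
rewrite leq_eqVlt => /orP[/eqP<-|/inv[]//].
by rewrite (submx_trans _ (addsmxSl _ _))// addsmxSr.
Qed.

(** * Determinants of four vectors *)

Lemma norm_det_le (R : numDomainType) (n : nat) (A : 'M[R]_n) (r : 'I_n -> R) :
  (forall i j, `|A i j| <= r i) -> `|\det A| <= n`!%:R * \prod_i r i.
Proof.
move=> Ar; rewrite /determinant; apply: le_trans (ler_norm_sum _ _ _) _.
rewrite -card_Sn -sumr_const mulr_suml.
have eqS (F : 'S_n -> R) : \sum_(s in 'S_n) F s = \sum_(s : 'S_n) F s.
  by apply: eq_bigl.
rewrite [leRHS](_ : _ = \sum_(s : 'S_n) \prod_i r i); last first.
  by apply: eq_big => // s _; rewrite mul1r.
apply: ler_sum => s _; rewrite normrM normr_sign mul1r normr_prod.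
by apply: ler_prod => i _; rewrite normr_ge0 Ar.
Qed.

Definition lform (R : realType) (c : 'cV[R]_4) (v : 'rV[R]_4) : R :=
  (v *m c) 0 0.

Definition rows4 (R : realType) (u v w x : 'rV[R]_4) : 'M[R]_4 :=
  \matrix_(i < 4) nth 0 [:: u; v; w; x] i.

(* Replacing the first column by [t] times the values of the form multiplies
   the determinant by [t], because the form has first coefficient 1. *)
Lemma det_form_le (R : realType) (c : 'cV[R]_4) (A : 'M[R]_4) (r : 'I_4 -> R)
    (t : R) :
  c 0 0 = 1 -> 0 < t ->
  (forall i, t * `|lform c (row i A)| <= r i) ->
  (forall i j, `|A i (lift 0 j)| <= r i) ->
  t * `|\det A| <= 24 * \prod_i r i.
Proof.
move=> c1 t0 hc hA.
pose B : 'M[R]_4 := \matrix_(i, j) if j == 0 then t * c i 0 else (i == j)%:R.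
have l0 (i : 'I_3) : (lift 0 i == 0 :> 'I_4) = false by [].
have trB : is_trig_mx B.
  apply/is_trig_mxP => i j ij; rewrite mxE; case: eqVneq => [j0|_].
    by move: ij; rewrite j0.
  by case: eqVneq ij => // ->; rewrite ltnn.
have dB : \det B = t.
  rewrite (det_trig trB) big_ord_recl mxE eqxx c1 mulr1 big1 ?mulr1// => i _.
  by rewrite mxE l0 eqxx.
have -> : t * `|\det A| = `|\det (A *m B)|.
  by rewrite det_mulmx dB normrM (gtr0_norm t0) mulrC.
apply: norm_det_le => i j; case: (unliftP 0 j) => [j' ->|->].
  rewrite mxE (bigD1 (lift 0 j'))//= big1 ?addr0.
    by rewrite mxE l0 eqxx mulr1.
  by move=> k kj; rewrite mxE l0 (negPf kj) mulr0.
apply: le_trans (hc i); rewrite -[X in X * _](gtr0_norm t0) -normrM.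
rewrite le_eqVlt; apply/orP; left; apply/eqP; congr (`|_|).
rewrite /lform !mxE mulr_sumr; apply: eq_bigr => k _.
by rewrite !mxE eqxx mulrCA.
Qed.

Lemma det_rows4_neq0 (R : realType) (u v w x : 'rV[R]_4) :
  \rank (u + v + w)%MS = 3 -> ~~ (x <= u + v + w)%MS ->
  \det (rows4 u v w x) != 0.
Proof.
move=> rk xn; rewrite -unitfE -unitmxE -row_full_unit -col_leq_rank.
apply: leq_trans (_ : \rank (u + v + w + x)%MS <= _)%N.
  by rewrite rank_adds_row// rk.
have sub (i : 'I_4) : (nth 0 [:: u; v; w; x] i <= rows4 u v w x)%MS.
  by rewrite -(rowK (fun i : 'I_4 => nth 0 [:: u; v; w; x] i)) row_sub.
rewrite mxrankS// !addsmx_sub.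
by rewrite (sub 0) (sub 1) (sub 2%:R) (sub 3%:R).
Qed.

Lemma det_rows4_eq0 (R : realType) (m : nat) (U : 'M[R]_(m, 4))
    (u v w x : 'rV[R]_4) :
  (\rank U < 4)%N -> (u <= U)%MS -> (v <= U)%MS -> (w <= U)%MS -> (x <= U)%MS ->
  \det (rows4 u v w x) = 0.
Proof.
move=> rk uU vU wU xU; apply/eqP; rewrite -[_ == 0]negbK -unitfE -unitmxE.
rewrite -row_full_unit -col_leq_rank -ltnNge (leq_ltn_trans _ rk)// mxrankS//.
apply/row_subP => -[[|[|[|[|//]]]] ?]; rewrite rowK//.
Qed.

(** Linearity in the last row: the additional determinant has all its rows in [U], of rank below 4,
    and vanishes. *)
Lemma det_rows4_shift (R : realType) (m : nat) (U : 'M[R]_(m, 4))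
    (u v w x y : 'rV[R]_4) (b : R) :
  (\rank U < 4)%N -> (u <= U)%MS -> (v <= U)%MS -> (w <= U)%MS -> (y <= U)%MS ->
  \det (rows4 u v w (x + b *: y)) = \det (rows4 u v w x).
Proof.
move=> rk uU vU wU yU.
rewrite (@determinant_multilinear _ _ _ (rows4 u v w x) (rows4 u v w y) 3%:R 1 b).
- by rewrite (@det_rows4_eq0 _ _ U u v w y)// mulr0 addr0 mul1r.
- by rewrite !rowK /= scale1r.
- by apply/matrixP => -[[|[|[|//]]] ?] j; rewrite !mxE.
- by apply/matrixP => -[[|[|[|//]]] ?] j; rewrite !mxE.
Qed.

Lemma det_int_norm_ge1 (R : realType) (n : nat) (A : 'M[int]_n) :
  \det (map_mx intr A : 'M[R]_n) != 0 -> 1 <= `|\det (map_mx intr A : 'M[R]_n)|.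
Proof.
rewrite det_map_mx intr_eq0 => d0.
by rewrite -intr_norm -[1]/(1%:~R) ler_int; move: d0; rewrite -normr_gt0; lia.
Qed.

(** * Integer points, their heights and the values of a form *)

(* A point of Z^4 has the constant term as coordinate 0 and the three
   variables, the only ones entering the height, as the other coordinates. *)
Definition hgt (z : 'rV[int]_4) : nat := \max_(i < 3) absz (z 0 (lift 0 i))%R.

Definition emb (R : realType) (z : 'rV[int]_4) : 'rV[R]_4 := map_mx intr z.

Definition zform (R : realType) (c : 'cV[R]_4) (z : 'rV[int]_4) : R :=
  lform c (emb R z).

(* The successive best approximations, from the first with value below 1 on. *)
Definition minimal_seq (R : realType) (c : 'cV[R]_4)
    (z : nat -> 'rV[int]_4) : Prop :=
  forall k, [/\ (0 < hgt (z k) < hgt (z k.+1))%N,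
    `|zform c (z k.+1)| < `|zform c (z k)| < 1 &
    forall w, (0 < hgt w < hgt (z k.+1))%N -> `|zform c (z k)| <= `|zform c w|].

(** The second clause is linear independence of the coefficients over the integers; the first makes
    the form integer-valued on points of height 0. *)
Definition nonvanishing (R : realType) (c : 'cV[R]_4) : Prop :=
  c 0 0 = 1 /\ forall w, zform c w = 0 -> w = 0.

(* For consecutive [u], [v] in the sequence the largest of these three minors is
   comparable to [`|lform c u|] times the height of [v], and it does not
   decrease as long as the sequence stays in one plane. *)
Definition cross (R : realType) (c : 'cV[R]_4) (i : 'I_3) (u v : 'rV[R]_4) : R :=
  u 0 (lift 0 i) * lform c v - v 0 (lift 0 i) * lform c u.

Lemma lformD (R : realType) (c : 'cV[R]_4) u v :
  lform c (u + v) = lform c u + lform c v.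
Proof. by rewrite /lform mulmxDl mxE. Qed.

Lemma lformZ (R : realType) (c : 'cV[R]_4) a u : lform c (a *: u) = a * lform c u.
Proof. by rewrite /lform -scalemxAl mxE. Qed.

Lemma emb_coord (R : realType) z j : emb R z 0 j = (z 0 j)%:~R.
Proof. by rewrite mxE. Qed.

Lemma emb_coord_le (R : realType) z i : `|emb R z 0 (lift 0 i)| <= (hgt z)%:R.
Proof.
rewrite emb_coord -intr_norm -[(hgt z)%:R]/((hgt z)%:Z%:~R) ler_int.
rewrite -abszE lez_nat.
exact: (@leq_bigmax _ (fun i : 'I_3 => absz (z 0 (lift 0 i)))).
Qed.

Lemma hgt_attained (R : realType) z :
  exists i, `|emb R z 0 (lift 0 i)| = (hgt z)%:R.
Proof.
have := @bigop.eq_bigmax _ (fun i : 'I_3 => absz (z 0 (lift 0 i))).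
rewrite card_ord => /(_ isT)[i hi].
by exists i; rewrite emb_coord -intr_norm -abszE /hgt hi.
Qed.

Lemma zform_hgt0 (R : realType) (c : 'cV[R]_4) z :
  c 0 0 = 1 -> hgt z = 0%N -> zform c z = (z 0 0)%:~R.
Proof.
move=> c1 hz; rewrite /zform /lform mxE big_ord_recl c1 mulr1 emb_coord.
rewrite big1 ?addr0// => i _.
have /eqP := emb_coord_le R z i; have := emb_coord_le R z i.
by rewrite hz normr_le0 => /eqP->; rewrite mul0r.
Qed.

Lemma zform_gt0 (R : realType) (c : 'cV[R]_4) w :
  nonvanishing c -> (0 < hgt w)%N -> 0 < `|zform c w|.
Proof.
move=> cnv; rewrite normr_gt0; apply: contraTneq => /cnv.2 ->.
by rewrite -leqNgt; apply/bigmax_leqP => i _; rewrite mxE.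
Qed.

Lemma near_int (R : realType) (x : R) : exists n : int, `|x - n%:~R| <= 1 / 2.
Proof.
exists (Num.floor (x + 1 / 2)).
have /andP[] := floor_itv (x + 1 / 2); rewrite intrD ler_norml => *.
by apply/andP; split; lra.
Qed.

(** * Minimal points: monotonicity, lattice bases and plane minors *)

Section MinimalSeq.
Variables (R : realType) (c : 'cV[R]_4) (z : nat -> 'rV[int]_4).
Hypotheses (cnv : nonvanishing c) (zmin : minimal_seq c z).

Let Z k : 'rV[R]_4 := emb R (z k).
Let X k : R := (hgt (z k))%:R.
Let L k : R := zform c (z k).

Lemma ms_L_gt0 k : 0 < `|L k|.
Proof.
by apply: zform_gt0 => //; have [/andP[]] := zmin k.
Qed.

Lemma ms_L_lt k : `|L k.+1| < `|L k|.
Proof. by have [_ /andP[]] := zmin k. Qed.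

Lemma ms_X_gt0 k : 0 < X k.
Proof. by rewrite ltr0n; have [/andP[]] := zmin k. Qed.

Lemma ms_X_lt k : X k < X k.+1.
Proof. by rewrite ltr_nat; have [/andP[]] := zmin k. Qed.

Lemma ms_X_le m n : (m <= n)%N -> X m <= X n.
Proof.
elim: n => [|n IH]; first by rewrite leqn0 => /eqP->.
rewrite leq_eqVlt ltnS => /orP[/eqP->//|/IH/le_trans]; apply.
exact/ltW/ms_X_lt.
Qed.

Lemma ms_L_le m n : (m <= n)%N -> `|L n| <= `|L m|.
Proof.
elim: n => [|n IH]; first by rewrite leqn0 => /eqP->.
rewrite leq_eqVlt ltnS => /orP[/eqP->//|/IH]; apply: le_trans.
exact/ltW/ms_L_lt.
Qed.

(** Positive height contradicts minimality; at height 0 the value is an integer of modulus below 1,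
    hence 0. *)
Lemma ms_small_eq0 k (w : 'rV[int]_4) :
  (hgt w < hgt (z k.+1))%N -> `|zform c w| < `|L k| -> w = 0.
Proof.
move=> hw Lw; have [_ /andP[_ L1] mn] := zmin k.
have [w0|w0] := posnP (hgt w); last first.
  by move: Lw; rewrite ltNge mn// w0.
apply: cnv.2; rewrite zform_hgt0 ?cnv.1//.
have : `|zform c w| < 1 by apply: lt_trans Lw L1.
rewrite zform_hgt0 ?cnv.1// -intr_norm -[1]/(1%:~R) ltr_int => ?.
by rewrite (_ : w 0 0 = 0)//; lia.
Qed.

(** A proportionality factor would have modulus below 1 because the form values decrease, whereas
    the heights increase. *)
Lemma ms_indep k (a : R) : Z k.+1 <> a *: Z k.
Proof.
move=> e.
have eL : `|L k.+1| = `|a| * `|L k| by rewrite -normrM -lformZ /L /zform -/(Z _) e.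
have a1 : `|a| < 1.
  by rewrite -(ltr_pM2r (ms_L_gt0 k)) mul1r -eL ms_L_lt.
have [i hi] := hgt_attained R (z k.+1).
have := ms_X_lt k; rewrite ltNge {1}/X -hi -/(Z _) e mxE normrM => /negP; apply.
apply: le_trans (emb_coord_le R (z k) i).
by rewrite -[leRHS]mul1r ler_wpM2r// ltW.
Qed.

Lemma ms_neq0 k : Z k != 0.
Proof.
apply/eqP => e; have := ms_L_gt0 k.
by rewrite /L /zform -/(Z k) e /lform mul0mx mxE normr0 ltxx.
Qed.

Lemma ms_rank_plane k : \rank (plane Z k) = 2.
Proof.
rewrite rank_adds_row ?rank_rV ?ms_neq0//.
by apply/negP => /sub_rVP[a]; apply: ms_indep.
Qed.

(* [z k] and [z k.+1] form a basis of the lattice of integer points of their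
   plane: rounding the coefficients produces an integer point too small to be
   nonzero. *)
Lemma ms_coplanar k : (Z k.+2 <= plane Z k)%MS ->
  exists a b, Z k.+2 = a *: Z k.+1 + b *: Z k /\ 1 <= `|b|.
Proof.
move=> /sub_addsmxP[[u v]] /=.
rewrite [u]mx11_scalar [v]mx11_scalar !mul_scalar_mx addrC.
move: (u 0 0) (v 0 0) => b a {u v} e; exists a, b; split=> //.
have [n hn] := near_int a; have [m hm] := near_int b.
pose w : 'rV[int]_4 := z k.+2 - n *: z k.+1 - m *: z k.
have ew : emb R w = (a - n%:~R) *: Z k.+1 + (b - m%:~R) *: Z k.
  have -> : emb R w = Z k.+2 - n%:~R *: Z k.+1 - m%:~R *: Z k.
    by apply/rowP => j; rewrite !mxE !(intrD, mulrNz, intrM).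
  by rewrite e; apply/rowP => j; rewrite !mxE; ring.
(* The remainders are at most 1/2, so [w] has height at most (X_(k+1) + X_k)/2 < X_(k+1) and form
   value at most (|L_(k+1)| + |L_k|)/2 < |L_k|. *)
have w0 : w = 0.
  apply: (@ms_small_eq0 k).
    have [i hi] := hgt_attained R w.
    rewrite -(ltr_nat R) -hi ew !mxE; apply: le_lt_trans (ler_normD _ _) _.
    rewrite !normrM.
    have h1 := emb_coord_le R (z k.+1) i; have h2 := emb_coord_le R (z k) i.
    have h3 := ms_X_lt k; rewrite /X in h3.
    rewrite !emb_coord in h1 h2.
    have := ler_pM (normr_ge0 _) (normr_ge0 _) hn h1.
    have := ler_pM (normr_ge0 _) (normr_ge0 _) hm h2.
    lra.
  rewrite /zform ew lformD !lformZ; apply: le_lt_trans (ler_normD _ _) _.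
  rewrite !normrM -![lform _ _]/(L _); have := ms_L_lt k.
  have := ler_wpM2r (normr_ge0 (L k.+1)) hn.
  have := ler_wpM2r (normr_ge0 (L k)) hm; lra.
have e0 : (a - n%:~R) *: Z k.+1 + (b - m%:~R) *: Z k = 0.
  by rewrite -ew w0 /emb map_mx0.
have an : a - n%:~R = 0.
  apply/eqP; apply: contrapT => /negP an.
  apply: (@ms_indep k (- (b - m%:~R) / (a - n%:~R))).
  apply: (scalerI an); rewrite scalerA mulrC divfK// scaleNr.
  by apply/eqP; rewrite -addr_eq0 e0.
move: e0; rewrite an scale0r add0r => /eqP.
rewrite scaler_eq0 (negPf (ms_neq0 k)) orbF subr_eq0 => /eqP bm.
(* Now [b] equals the integer [m], and it is nonzero since [Z k.+2] is not a multiple of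
   [Z k.+1]. *)
have b0 : b != 0.
  apply/eqP => b0; apply: (@ms_indep k.+1 a).
  by rewrite e b0 scale0r addr0.
move: b0; rewrite bm intr_eq0 => m0.
by rewrite -intr_norm -[1]/(1%:~R) ler_int; move: m0; lia.
Qed.

Lemma ms_cross_le k i : `|cross c i (Z k) (Z k.+1)| <= 2 * (`|L k| * X k.+1).
Proof.
apply: le_trans (ler_normB _ _) _; rewrite !normrM -![lform _ _]/(L _).
have h1 : `|Z k 0 (lift 0 i)| <= X k.+1.
  by apply: le_trans (emb_coord_le _ _ _) _; apply/ltW/ms_X_lt.
have h2 : `|Z k.+1 0 (lift 0 i)| <= X k.+1 by exact: emb_coord_le.
have := ler_pM (normr_ge0 _) (normr_ge0 _) h1 (ltW (ms_L_lt k)).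
have := ler_wpM2r (normr_ge0 (L k)) h2.
lra.
Qed.

(** The minor is bilinear and alternating, so replacing [Z k.+2] by its expression in the basis
    multiplies it by [- b]. *)
Lemma ms_cross_coplanar k i : (Z k.+2 <= plane Z k)%MS ->
  `|cross c i (Z k) (Z k.+1)| <= `|cross c i (Z k.+1) (Z k.+2)|.
Proof.
move=> /ms_coplanar[a [b [-> b1]]].
have -> : cross c i (Z k.+1) (a *: Z k.+1 + b *: Z k) =
    - b * cross c i (Z k) (Z k.+1).
  by rewrite /cross lformD !lformZ !mxE; ring.
by rewrite normrM normrN -{1}[`|cross _ _ _ _|]mul1r ler_wpM2r.
Qed.

End MinimalSeq.

(** * Plane invariants and determinants of minimal points *)

Section MinimalSeqBounds.
Variables (R : realType) (c : 'cV[R]_4) (z : nat -> 'rV[int]_4).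
Hypotheses (cnv : nonvanishing c) (zmin : minimal_seq c z).

Let Z k : 'rV[R]_4 := emb R (z k).
Let X k : R := (hgt (z k))%:R.
Let L k : R := zform c (z k).

Let L_gt0 k : 0 < `|L k|. Proof. exact: ms_L_gt0. Qed.
Let L_lt k : `|L k.+1| < `|L k|. Proof. exact: ms_L_lt. Qed.
Let X_gt0 k : 0 < X k. Proof. exact: (ms_X_gt0 zmin). Qed.
Let X_lt k : X k < X k.+1. Proof. exact: (ms_X_lt zmin). Qed.

Let X_le m n : (m <= n)%N -> X m <= X n. Proof. exact: (ms_X_le zmin). Qed.
Let L_le m n : (m <= n)%N -> `|L n| <= `|L m|. Proof. exact: (ms_L_le zmin). Qed.

Let rk2 k : \rank (Z k + Z k.+1)%MS = 2.
Proof. exact: (ms_rank_plane cnv zmin). Qed.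

Lemma ms_cross_ge k :
  exists i, `|L k| * X k.+1 <= 2 * `|cross c i (Z k) (Z k.+1)|.
Proof.
(* If [`|L k.+1|] is small, a coordinate realising the height of [z k.+1]
   works.  Otherwise choose the sign [s] so that [z k.+1 - s *: z k] has a
   smaller form value than [z k]; its height is then at least that of
   [z k.+1], which forces [z k.+1] and [s *: z k] to have opposite signs in
   some coordinate. *)
have [small|big] := lerP (2 * `|L k.+1|) `|L k|.
  have [i hi] := hgt_attained R (z k.+1); exists i.
  have h1 := emb_coord_le R (z k) i; rewrite -/(Z _) in h1.
  rewrite -/(X _) -/(Z _) in hi.
  have : `|Z k.+1 0 (lift 0 i) * L k| - `|Z k 0 (lift 0 i) * L k.+1| <=
      `|cross c i (Z k) (Z k.+1)|.
    by rewrite /cross distrC -![lform _ _]/(L _); exact: lerB_dist.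
  rewrite !normrM hi.
  have h2 : `|Z k 0 (lift 0 i)| * `|L k.+1| <= X k * `|L k.+1|.
    by rewrite ler_wpM2r.
  have h3 : X k * `|L k.+1| <= X k.+1 * `|L k.+1| by rewrite ler_wpM2r// ltW.
  have := ler_wpM2l (ltW (X_gt0 k.+1)) small; lra.
have [s [s1 sL]] : exists s : int, `|s| = 1 /\ 0 < s%:~R * L k * L k.+1.
  have n0 : L k * L k.+1 != 0 by rewrite mulf_neq0// -normr_gt0.
  have [pos|neg] := ltP 0 (L k * L k.+1).
    by exists 1; rewrite mul1r normr1.
  exists (-1); rewrite normrN1; split=> //.
  by rewrite intrN !mulN1r mulNr oppr_gt0 lt_neqAle n0.
have s1R : `|s%:~R : R| = 1 by rewrite -intr_norm s1.
have eLk : `|L k| = `|s%:~R * L k| by rewrite normrM s1R mul1r.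
pose w : 'rV[int]_4 := z k.+1 - s *: z k.
have ew : emb R w = Z k.+1 + (- s%:~R) *: Z k.
  by apply/rowP => j; rewrite !mxE !(intrD, mulrNz, intrM) mulNr.
have w0 : w <> 0.
  move=> w0; apply: (@ms_indep R c z cnv zmin k s%:~R).
  apply/eqP; rewrite -subr_eq0 -scaleNr -[_ + _]ew w0.
  by apply/eqP/rowP => j; rewrite !mxE.
have Lw : `|zform c w| < `|L k|.
  rewrite /zform ew lformD lformZ -![lform _ _]/(L _).
  have := L_gt0 k.+1; have := L_lt k; move: sL.
  rewrite eLk; set l := s%:~R * L k => sL lt pos.
  have -> : L k.+1 + - s%:~R * L k = L k.+1 - l by rewrite mulNr.
  clearbody l; move: (L k.+1) sL lt pos => l'.
  by case: (ger0P l) => ?; case: (ger0P l') => ?; rewrite ltr_norml => *;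
    apply/andP; split; nra.
have hw : X k.+1 <= (hgt w)%:R.
  rewrite ler_nat leqNgt; apply/negP => hw; apply: w0.
  exact: (@ms_small_eq0 R c z cnv zmin k).
have [i hi] := hgt_attained R w; exists i.
move: hw; rewrite -hi ew !mxE.
have : `|Z k.+1 0 (lift 0 i)| <= X k.+1 by exact: emb_coord_le.
have : `|s%:~R * Z k 0 (lift 0 i)| < X k.+1.
  by rewrite normrM s1R mul1r; exact: le_lt_trans (emb_coord_le _ _ _) (X_lt k).
have -> : `|cross c i (Z k) (Z k.+1)| =
    `|s%:~R * Z k 0 (lift 0 i) * L k.+1 - Z k.+1 0 (lift 0 i) * (s%:~R * L k)|.
  transitivity (`|s%:~R| * `|cross c i (Z k) (Z k.+1)|).
    by rewrite s1R mul1r.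
  rewrite -normrM /cross -![lform _ _]/(L _).
  by congr (`|_|); ring.
move: sL big (L_lt k) (X_gt0 k.+1) (L_gt0 k.+1); rewrite eLk.
rewrite !emb_coord mulNr.
move: (s%:~R * L k) (L k.+1) (X k.+1) => l l' x.
move: (s%:~R * _) ((z k.+1 0 (lift 0 i))%:~R) => p q.
move=> ll big lt x0 l'0 px qx xqp.
have pq : p * q <= 0.
  rewrite leNgt; apply/negP => pq; move: xqp; rewrite leNgt => /negP; apply.
  rewrite ltr_norml; move: px qx; rewrite ltr_norml ler_norml.
  by move=> /andP[? ?] /andP[? ?]; apply/andP; split; nra.
(* As [l] and [l'] have the same sign while [p] and [q] do not, there is no cancellation. With |p| +
   |q| >= x and |l| < 2|l'| this gives the factor 2. *)
have e1 : `|p * l' - q * l| = `|p| * `|l'| + `|q| * `|l|.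
  have : (p * l') * (q * l) <= 0.
    by rewrite mulrACA (mulrC l') mulr_le0_ge0// ltW.
  rewrite -!normrM; move: (p * l') (q * l) => u v uv.
  have [u0|u0|->] := ltgtP u 0; last by rewrite sub0r normrN normr0 add0r.
    have v0 : 0 <= v by nra.
    by rewrite (ltr0_norm u0) (ger0_norm v0) ler0_norm; lra.
  have v0 : v <= 0 by nra.
  by rewrite (gtr0_norm u0) (ler0_norm v0) ger0_norm; lra.
rewrite e1.
have e2 : x <= `|q| + `|p| by apply: le_trans xqp (ler_normB _ _).
have := normr_ge0 p; have := normr_ge0 q; nra.
Qed.

(** A minor comparable to |L_k| X_(k+1) does not decrease while the plane is fixed; each of the two
    comparisons costs a factor 2. *)
Lemma ms_coplanar_area k l : (k <= l)%N ->
  (forall j, (k <= j < l)%N -> (Z j.+2 <= plane Z j)%MS) ->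
  `|L k| * X k.+1 <= 4 * (`|L l| * X l.+1).
Proof.
move=> kl cop; have [i hi] := ms_cross_ge k.
have mono : `|cross c i (Z k) (Z k.+1)| <= `|cross c i (Z l) (Z l.+1)|.
  elim: l kl cop => [|l IH]; first by rewrite leqn0 => /eqP->.
  rewrite leq_eqVlt => /orP[/eqP->//|kl] cop.
  apply: le_trans (IH _ _) _ => //.
    by move=> j /andP[kj jl]; apply: cop; rewrite kj ltnW.
  by apply: ms_cross_coplanar => //; apply: cop; rewrite ltnSn andbT.
have := ms_cross_le zmin l i; rewrite -/(Z _) -/(Z _) -/(L _) -/(X _); lra.
Qed.

(** The form is scaled by X_k / |L_k|. Since heights increase and form values decrease, each row
    [Z j] with j >= k is then bounded by X_j in every column, and the hypothesis on [v] says the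
    same of the last row with [r]. *)
Lemma ms_det_le k l (v : 'rV[R]_4) (r : R) : (k < l)%N ->
  (forall i, `|v 0 (lift 0 i)| <= r) ->
  X k * `|lform c v| <= r * `|L k| ->
  `|\det (rows4 (Z k) (Z k.+1) (Z l.+1) v)| <=
    24 * (`|L k| * X k.+1 * X l.+1 * r).
Proof.
move=> kl hv hLv.
have t0 : 0 < X k / `|L k| by rewrite divr_gt0.
have key j : (k <= j)%N -> X k / `|L k| * `|L j| <= X j.
  move=> kj; rewrite mulrAC ler_pdivrMr//.
  by apply: ler_pM; rewrite ?normr_ge0 ?X_le ?L_le// ltW.
have ? : (k <= l.+1)%N by exact/ltnW/ltnW.
pose r4 (i : 'I_4) := nth 0 [:: X k; X k.+1; X l.+1; r] i.
have hrow i : X k / `|L k| *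
    `|lform c (row i (rows4 (Z k) (Z k.+1) (Z l.+1) v))| <= r4 i.
  case: i => -[|[|[|[|//]]]] ?; rewrite rowK; [exact: key|exact: key|exact: key|].
  by rewrite /= mulrAC ler_pdivrMr.
have hcoord i j : `|rows4 (Z k) (Z k.+1) (Z l.+1) v i (lift 0 j)| <= r4 i.
  by case: i => -[|[|[|[|//]]]] ?; rewrite mxE //=; exact: emb_coord_le.
have := det_form_le cnv.1 t0 hrow hcoord.
rewrite !big_ord_recl big_ord0 /r4 /= mulr1 mulrAC ler_pdivrMr// => h.
rewrite -(ler_pM2l (X_gt0 k)); apply: le_trans h _.
by rewrite le_eqVlt; apply/orP; left; apply/eqP; ring.
Qed.

Lemma ms_four_indep k l : (k.+2 <= l)%N -> ~~ (Z k.+2 <= plane Z k)%MS ->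
  ~~ (Z l.+1 <= plane Z k + Z k.+2)%MS ->
  1 <= 24 * (`|L k| * X k.+1 * X k.+2 * X l.+1).
Proof.
move=> kl chg fou; have kl1 : (k <= l.+1)%N by lia.
apply: le_trans (@ms_det_le k k.+1 (Z l.+1) (X l.+1) _ _ _) => //; last 2 first.
- by move=> i; exact: emb_coord_le.
- by apply: ler_pM; rewrite ?normr_ge0 ?X_le ?L_le// ltW.
have eM : rows4 (Z k) (Z k.+1) (Z k.+2) (Z l.+1) = map_mx intr
    (\matrix_(i < 4) nth 0 [:: z k; z k.+1; z k.+2; z l.+1] i).
  by apply/matrixP => -[[|[|[|[|//]]]] ?] j; rewrite !mxE.
rewrite eM; apply: det_int_norm_ge1; rewrite -eM.
by apply: det_rows4_neq0; [rewrite rank_adds_row ?rk2 | exact: fou].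
Qed.

(* The fourth vector is a real vector in the kernel of the form that differs
   from a standard basis vector by an element of [U]. *)
Lemma ms_three_indep (U : 'M[R]_4) N : \rank U = 3 ->
  (forall j, (N <= j)%N -> (Z j <= U)%MS) ->
  exists2 C, 0 < C & forall k, (N <= k)%N -> ~~ (Z k.+2 <= plane Z k)%MS ->
  1 <= C * (`|L k| * X k.+1 * X k.+2).
Proof.
move=> rU ZU.
(* A space of rank 3 misses some standard basis vector. *)
have [m em] : exists m : 'I_4, ~~ (emb R (delta_mx 0 m) <= U)%MS.
  apply: contrapT => no.
  have : (1%:M <= U)%MS.
    apply/row_subP => m; apply: contrapT => /negP mU; apply: no; exists m.
    apply: contraNN mU => mU; suff -> : row m 1%:M = emb R (delta_mx 0 m) by [].
    by apply/rowP => j; rewrite !mxE eqxx /= eq_sym; case: (j == m).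
  by move=> /mxrankS; rewrite mxrank1 rU.
pose e := emb R (delta_mx 0 m); pose b := - (lform c e / L N).
(* The coefficient [b] is chosen so that the form vanishes at [v]. *)
have LN0 : L N != 0 by rewrite -normr_gt0.
pose v := e + b *: Z N.
have Lv : lform c v = 0.
  by rewrite lformD lformZ -[lform c (Z N)]/(L N) /b mulNr divfK// subrr.
pose r := 1 + \sum_i `|v 0 i|.
have r0 : 0 < r by rewrite ltr_pwDl// sumr_ge0.
exists (24 * r); first by rewrite mulr_gt0.
move=> k Nk chg.
rewrite [leRHS](_ : _ = 24 * (`|L k| * X k.+1 * X k.+2 * r)); last by ring.
apply: le_trans (@ms_det_le k k.+1 v r _ _ _) => //; last 2 first.
- move=> i; rewrite /r (bigD1 (lift 0 i))//= addrCA ler_wpDr// addr_ge0//.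
  by rewrite sumr_ge0.
- by rewrite Lv normr0 mulr0 mulr_ge0// ltW.
have [U0 U1 U2] : [/\ (Z k <= U)%MS, (Z k.+1 <= U)%MS & (Z k.+2 <= U)%MS].
  by split; apply: ZU; lia.
(* Removing the multiple of [Z N], which lies in [U], leaves an integer determinant. *)
rewrite /v (@det_rows4_shift _ _ U) ?rU ?U0 ?U1 ?U2 ?ZU//.
have eM : rows4 (Z k) (Z k.+1) (Z k.+2) e = map_mx intr
    (\matrix_(i < 4) nth 0 [:: z k; z k.+1; z k.+2; delta_mx 0 m] i).
  by apply/matrixP => -[[|[|[|[|//]]]] ?] j; rewrite !mxE.
rewrite eM; apply: det_int_norm_ge1; rewrite -eM.
apply: det_rows4_neq0; first by rewrite rank_adds_row ?rk2.
apply: contra em => /submx_trans; apply; rewrite !addsmx_sub.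
by rewrite U0 U1 U2.
Qed.

End MinimalSeqBounds.

(** * The inequality between the exponents along a sequence of minimal points *)

Section ExponentInequality.
Variables (R : realType) (c : 'cV[R]_4) (z : nat -> 'rV[int]_4).
Hypotheses (cnv : nonvanishing c) (zmin : minimal_seq c z).

Let Z k : 'rV[R]_4 := emb R (z k).
Let X k : R := (hgt (z k))%:R.
Let L k : R := zform c (z k).

Lemma ms_ln_hgt_unbounded (B : R) : exists N, forall k, (N <= k)%N -> B < ln (X k).
Proof.
exists (Num.truncn (expR B)) => k Nk.
rewrite -ltr_expR lnK ?posrE ?(ms_X_gt0 zmin)//.
have hk : (k < hgt (z k))%N.
  elim: k {Nk} => [|k IH]; first by have [/andP[]] := zmin 0.
    by have [/andP[_ +] _ _] := zmin k; exact: leq_ltn_trans.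
apply: lt_le_trans (truncnS_gt (expR B)) _.
by rewrite ler_nat; exact: leq_ltn_trans Nk hk.
Qed.

Lemma ms_exponent_inequality (a b C : R) (N0 : nat) : 1 < a -> 0 <= b ->
  (forall k, (N0 <= k)%N -> ln `|L k| <= C - a * ln (X k.+1)) ->
  (forall k, (N0 <= k)%N -> - (b * ln (X k)) <= ln `|L k|) ->
  a - 1 <= b / a + (b / a) ^+ 2.
Proof.
move=> a1 b0 Ha Hb; rewrite leNgt; apply/negP.
set g := b / a => hD.
have ag : b = a * g by rewrite /g mulrC divfK// gt_eqF// (lt_trans _ a1).
have g0 : 0 <= g by rewrite divr_ge0// ltW// (lt_trans _ a1).
have X0 k : X k \is Num.pos by rewrite posrE (ms_X_gt0 zmin).
have L0 k : `|L k| \is Num.pos by rewrite posrE (ms_L_gt0 cnv zmin).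
have lnle x y : x \is Num.pos -> x <= y -> ln x <= ln y :> R.
  by rewrite posrE => x0 xy; rewrite ler_ln ?posrE// (lt_le_trans x0).
have p1 : (1 : R) \is Num.pos by rewrite posrE.
have p4 : (4 : R) \is Num.pos by rewrite posrE.
have p24 : (24 : R) \is Num.pos by rewrite posrE.
(* The two hypotheses together: X_(k+1) << X_k^g. *)
have step k : (N0 <= k)%N -> ln (X k.+1) <= g * ln (X k) + C / a.
  move=> k0; have := le_trans (Hb k k0) (Ha k k0); rewrite ag => h.
  rewrite -(ler_pM2l (lt_trans ltr01 a1)) mulrDr.
  by rewrite [a * (C / a)]mulrC divfK ?gt_eqF ?(lt_trans _ a1)//; lra.
have area k l : (k <= l)%N ->
    (forall j, (k <= j < l)%N -> (Z j.+2 <= plane Z j)%MS) ->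
    ln `|L k| + ln (X k.+1) <= ln 4 + (ln `|L l| + ln (X l.+1)).
  move=> kl cop; have := lnle _ _ _ (ms_coplanar_area cnv zmin kl cop).
  by rewrite -/(X _) -/(X _) -/(L _) -/(L _) !lnM ?rpredM//; apply.
have chg N : exists2 k, (N <= k)%N & ~~ (Z k.+2 <= plane Z k)%MS.
  (* In an eventually constant plane |L_l| X_(l+1) would stay bounded below, but it is at most a
     constant times X_(l+1)^(1-a), which tends to 0. *)
  apply: contrapT => no.
  have cop j : (N <= j)%N -> (Z j.+2 <= plane Z j)%MS.
    by move=> Nj; apply: contrapT => /negP h; apply: no; exists j.
  pose A := ln `|L N| + ln (X N.+1) - ln 4 - C.
  have [M hM] := ms_ln_hgt_unbounded (- A / (a - 1)).
  pose l := maxn N (maxn M N0).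
  have lM : (M <= l.+1)%N by rewrite leqW// /l !leq_max leqnn orbT.
  have := hM _ lM; rewrite ltr_pdivrMr ?subr_gt0//.
  have /Ha : (N0 <= l)%N by rewrite /l !leq_max leqnn !orbT.
  have Nl : (N <= l)%N by exact: leq_maxl.
  have := @area N l Nl (fun j => fun h => cop j (proj1 (andP h))).
  by rewrite /A; nra.
have big K D : 0 < D -> exists N, forall k, (N <= k)%N -> K < D * ln (X k).
  move=> D0; have [N hN] := ms_ln_hgt_unbounded (K / D); exists N => k /hN.
  by rewrite ltr_pdivrMr// mulrC.
have D2 : 0 < a - 1 - g by have := sqr_ge0 g; lra.
case: (plane_dichotomy (ms_rank_plane cnv zmin) chg) => [[U [N [rU ZU]]]|good].
  (* Three-dimensional case: the determinant yields (a - 1 - g) ln X_(k+1) <= ln K + C + C/a,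
     impossible for large [k]. *)
  have [K K0 hK] := ms_three_indep cnv zmin rU ZU.
  have [M hM] := big (ln K + C + C / a) _ D2.
  have [k kk kchg] := chg (maxn N (maxn M N0)).
  have := lnle _ _ p1 (hK k (leq_trans (leq_maxl _ _) kk) kchg).
  rewrite -posrE in K0.
  rewrite -/(X _) -/(X _) -/(L _) ln1 !lnM ?rpredM//.
  have := Ha k; have := step k.+1; have := hM k.+1.
  move: kk; rewrite !geq_max => /and3P[_ Mk Nk].
  by move=> /(_ (leqW Mk)) ? /(_ (leqW Nk)) ? /(_ Nk) ?; lra.
(* Error terms of the determinant bound, of the growth bound [step] and of the plane comparison, in
   this order. *)
pose K1 := ln 24 + C; pose K2 := C / a; pose K3 := ln 4 + C.
have D3 : 0 < (a - 1) * (a - 1 - g - g ^+ 2).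
  by rewrite mulr_gt0 ?subr_gt0//; lra.
have [M hM] := big ((a - 1) * K1 + (a - 1) * K2 + g * K3 + (a - 1 - g) * K2) _ D3.
have [k [l [kk kl kchg cop fou]]] := good (maxn M N0).
have := lnle _ _ p1 (ms_four_indep cnv zmin kl kchg fou).
rewrite -/(X _) -/(X _) -/(X _) -/(L _) ln1 !lnM ?rpredM//.
(* From here [l] is one less than before: the fourth point is [Z l.+2], and the intermediate plane
   ends with [Z l], [Z l.+1]. *)
case: l kl cop fou => // l kl cop fou.
have /andP[Mk Nk] : (M <= k)%N && (N0 <= k)%N by rewrite -geq_max.
have Nl : (N0 <= l)%N by rewrite (leq_trans Nk)// ltnW.
have ar : ln `|L k.+1| + ln (X k.+2) <= ln 4 + (ln `|L l| + ln (X l.+1)).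
  apply: area => // j /andP[kj jl].
  have PP : (plane Z k.+1 <= plane Z j)%MS.
    apply: rank_sub_eq; last by rewrite !(ms_rank_plane cnv zmin).
    by rewrite addsmx_sub !cop//; apply/andP; split=> //; apply: leqW => //; apply: ltnW.
  by apply: submx_trans PP; apply: cop; rewrite !ltnS jl andbT ltnW// leqW.
have hu : (a - 1) * K1 + (a - 1) * K2 + g * K3 + (a - 1 - g) * K2 <
  (a - 1) * (a - 1 - g - g ^+ 2) * ln (X k.+1) by exact/hM/leqW.
have h1 : ln `|L k| <= C - a * ln (X k.+1) by exact: Ha.
have h2 : ln (X l.+2) <= g * ln (X l.+1) + C / a by exact/step/leqW.
have h3 : ln (X k.+2) <= g * ln (X k.+1) + C / a by exact/step/leqW.
have h4 : ln `|L l| <= C - a * ln (X l.+1) by exact: Ha.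
have h5 : - (b * ln (X k.+1)) <= ln `|L k.+1| by exact/Hb/leqW.
move: (ln (X k.+1)) (ln (X k.+2)) (ln (X l.+1)) (ln (X l.+2)) ar hu h1 h2 h3 h4 h5
  => u v p q ar hu h1 h2 h3 h4 h5 h6.
have e1 : (a - 1) * u <= v + q + K1 by rewrite /K1; lra.
have e2 : (a - 1) * p <= a * g * u - v + K3 by rewrite -ag /K3; lra.
rewrite -/K2 in h2 h3.
(* The weights a - 1, a - 1, g, a - 1 - g on [e1], [h2], [e2], [h3] eliminate [q], [p] and [v]. What
   remains bounds (a - 1)(a - 1 - g - g^2) u by a constant, against [hu]. *)
have f1 := ler_wpM2l (ltW (etrans (subr_gt0 1 a) a1)) e1.
have f2 := ler_wpM2l (ltW (etrans (subr_gt0 1 a) a1)) h2.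
have f3 := ler_wpM2l g0 e2.
have f4 := ler_wpM2l (ltW D2) h3.
nra.
Qed.

End ExponentInequality.

(** * Existence of minimal points and passage to bounds at all heights *)

Section Existence.
Variables (R : realType) (c : 'cV[R]_4).
Hypothesis cnv : nonvanishing c.

(** The height ignores coordinate 0; this bound makes the set of points of bounded height and
    bounded form value finite. *)
Lemma zform_coord0_le (w : 'rV[int]_4) :
  `|emb R w 0 0| <= `|zform c w| + (hgt w)%:R * \sum_i `|c (lift 0 i) 0|.
Proof.
have -> : emb R w 0 0 = zform c w - \sum_i emb R w 0 (lift 0 i) * c (lift 0 i) 0.
  have c1 := cnv.1; apply/eqP; rewrite eq_sym subr_eq.
  by rewrite {1}/zform /lform mxE big_ord_recl c1 mulr1.
apply: le_trans (ler_normB _ _) _; rewrite lerD2l.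
apply: le_trans (ler_norm_sum _ _ _) _; rewrite mulr_sumr ler_sum// => i _.
by rewrite normrM ler_wpM2r// emb_coord_le.
Qed.

Lemma zform_min_exists (n : nat) (w0 : 'rV[int]_4) : (0 < hgt w0 <= n)%N ->
  exists2 z, (0 < hgt z <= n)%N &
    forall w, (0 < hgt w <= n)%N -> `|zform c z| <= `|zform c w|.
Proof.
move=> w0n.
(* All points at least as good as [w0] have coordinates between -B and B; shifting by [B] encodes
   them in a finite type. *)
pose B := Num.truncn (n%:R + (`|zform c w0| + n%:R * \sum_i `|c (lift 0 i) 0|)).
pose dec (f : {ffun 'I_4 -> 'I_(B.*2.+1)}) : 'rV[int]_4 :=
  \row_j ((f j)%:Z - B%:Z).
have box w : (hgt w <= n)%N -> `|zform c w| <= `|zform c w0| ->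
    exists f, dec f = w.
  move=> wn ww0.
  have s0 : 0 <= \sum_i `|c (lift 0 i) 0| by exact: sumr_ge0.
  have wB (j : 'I_4) : (absz (w 0%R j) <= B)%N.
    rewrite truncn_ge_nat; last by rewrite addr_ge0// addr_ge0// mulr_ge0.
    have -> : (absz (w 0 j))%:R = `|emb R w 0 j|.
      by rewrite emb_coord -intr_norm -abszE.
    have wnR : (hgt w)%:R <= n%:R :> R by rewrite ler_nat.
    have [i ->|->] := unliftP 0 j.
      apply: le_trans (emb_coord_le _ _ _) _; apply: le_trans wnR _.
      by rewrite lerDl addr_ge0// mulr_ge0.
    apply: le_trans (zform_coord0_le w) _.
    by rewrite ler_wpDl// lerD// ler_wpM2r.
  exists [ffun j => inord (absz (w 0 j + B%:Z))].
  apply/rowP => j; rewrite mxE ffunE inordK; have := wB j; lia.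
have [f0 f0w] := box w0 (andP w0n).2 (lexx _).
have P0 : (0 < hgt (dec f0) <= n)%N by rewrite f0w.
case: (@arg_minP _ _ _ f0 (fun f => (0 < hgt (dec f) <= n)%N)
  (fun f => `|zform c (dec f)|) P0) => f Pf fmin.
exists (dec f) => // w wn.
have [ww0|/ltW ww0] := lerP `|zform c w| `|zform c w0|.
  by have [g gw] := box w (andP wn).2 ww0; rewrite -gw fmin// gw.
by apply: le_trans ww0; rewrite -f0w fmin.
Qed.

Hypothesis small : forall e : R, 0 < e ->
  exists2 w, (0 < hgt w)%N & `|zform c w| < e.

(** From a best approximation, let [n] be the least height at which it is beaten. A minimiser among
    the points of height at most [n] has height exactly [n] and is the next term; iteration gives
    the sequence. *)
Lemma minimal_seq_exists : exists z, minimal_seq c z.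
Proof.
pose good z := (0 < hgt z)%N /\ `|zform c z| < 1 /\
  forall w, (0 < hgt w <= hgt z)%N -> `|zform c z| <= `|zform c w|.
pose next z z' := [/\ (hgt z < hgt z')%N, `|zform c z'| < `|zform c z| &
  forall w, (0 < hgt w < hgt z')%N -> `|zform c z| <= `|zform c w|].
have step z : exists z', good z -> good z' /\ next z z'.
  have [gz|] := pselect (good z); last by exists z.
  have [z0 [z1 zm]] := gz.
  have Lz := zform_gt0 cnv z0.
  pose P n := `[< exists2 w, (0 < hgt w <= n)%N & `|zform c w| < `|zform c z| >].
  have exP : exists n, P n.
    by have [w w0 wz] := small Lz; exists (hgt w); apply/asboolP; exists w;
      rewrite ?w0 ?leqnn.
  case: (ex_minnP exP) => n /asboolP[w wn wz] nmin.
  have [z' z'n z'm] := zform_min_exists wn.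
  have /andP[z'0 z'n2] := z'n.
  have z'z : `|zform c z'| < `|zform c z| by apply: le_lt_trans (z'm w wn) wz.
  have mn v : (0 < hgt v)%N -> `|zform c v| < `|zform c z| -> (n <= hgt v)%N.
    by move=> v0 vz; apply: nmin; apply/asboolP; exists v; rewrite ?v0 ?leqnn.
  have hz' : hgt z' = n by apply/eqP; rewrite eqn_leq z'n2 mn.
  exists z' => _; split.
    split=> //; split; first exact: lt_trans z1.
    by rewrite hz'.
  split=> //.
    rewrite ltnNge; apply/negP => hle.
    by have := zm z'; rewrite z'0 hle leNgt z'z => /(_ isT).
  move=> v /andP[v0 vz']; rewrite leNgt; apply/negP => /(mn v v0).
  by rewrite leqNgt -hz' vz'.
have [f hf] := choice step.
have [w w0 w1] := small ltr01.
have wn : (0 < hgt w <= hgt w)%N by rewrite w0 leqnn.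
have [z0 z0n z0m] := zform_min_exists wn.
have g0 : good z0.
  split; first by case/andP: z0n.
  split; first by apply: le_lt_trans (z0m w wn) w1.
  move=> v /andP[v0 vz]; apply: z0m; rewrite v0 (leq_trans vz)//.
  by case/andP: z0n.
have gk k : good (iter k f z0) by elim: k => //= k /hf[].
exists (fun k => iter k f z0) => k.
have [_ [n1 n2 n3]] := hf _ (gk k); have [h0 [h1 _]] := gk k.
by rewrite h0 n1 n2 h1; split.
Qed.

End Existence.

Lemma exponent_inequality (R : realType) (c : 'cV[R]_4) (a b C : R) (N0 : nat) :
  nonvanishing c -> 1 < a -> 0 <= b ->
  (forall n, (N0 < n)%N ->
    exists2 w, (0 < hgt w <= n)%N & `|zform c w| <= C * n%:R `^ (- a)) ->
  (forall w, (N0 < hgt w)%N -> (hgt w)%:R `^ (- b) <= `|zform c w|) ->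
  a - 1 <= b / a + (b / a) ^+ 2.
Proof.
move=> cnv a1 b0 Ha Hb.
have a0 : 0 < a by exact: lt_trans a1.
have small (e : R) : 0 < e -> exists2 w, (0 < hgt w)%N & `|zform c w| < e.
  move=> e0.
  (* Beyond [m] the hypothesis applies, and n^(-a) <= 1/n makes the bound smaller than [e]. *)
  pose m := `|C| / e + N0%:R + 1.
  have m0 : 0 < m by rewrite ltr_wpDl// addr_ge0// divr_ge0// ltW.
  pose n := (Num.truncn m).+1.
  have mn : m < n%:R by exact: truncnS_gt.
  have n0 : 0 < n%:R :> R by rewrite ltr0n.
  have n1 : 1 <= n%:R :> R by rewrite ler1n.
  have Nn : (N0 < n)%N.
    rewrite -(ltr_nat R); apply: le_lt_trans mn; rewrite /m.
    by have := divr_ge0 (normr_ge0 C) (ltW e0); lra.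
  have [w /andP[w0 _] Lw] := Ha n Nn; exists w => //.
  apply: le_lt_trans Lw _; apply: le_lt_trans (_ : `|C| * n%:R `^ (- 1) < _).
    apply: le_trans (ler_wpM2r (powR_ge0 _ _) (ler_norm C)) _.
    by rewrite ler_wpM2l// ler_powR// lerN2 ltW.
  rewrite powRN powRr1; last exact: ltW.
  rewrite ltr_pdivrMr// mulrC -ltr_pdivrMr//; apply: le_lt_trans mn.
  by rewrite /m -addrA lerDl addr_ge0.
have [z zmin] := minimal_seq_exists cnv small.
have [N hN] := ms_ln_hgt_unbounded zmin (ln (N0.+2%:R)).
have X0 k : 0 < (hgt (z k))%:R :> R by exact: ms_X_gt0 zmin k.
have L0 k : 0 < `|zform c (z k)| by exact: ms_L_gt0.
have hN' k : (N <= k)%N -> (N0.+2 < hgt (z k))%N.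
  by move=> /hN; rewrite ltr_ln ?posrE// ltr_nat.
have C0 : 0 < C.
  have [w /andP[w0 _] Lw] := Ha N0.+1 (ltnSn _).
  have := lt_le_trans (zform_gt0 cnv w0) Lw.
  by rewrite pmulr_lgt0// powR_gt0 ltr0n.
apply: (ms_exponent_inequality cnv zmin (C := ln C + a * ln 2) (N0 := N)) => //.
- move=> k Nk; have Nk1 : (N0.+2 < hgt (z k.+1))%N by rewrite hN'// leqW.
  (* At height X_(k+1) - 1 no point beats [z k], so the bound there holds for [z k]. Since X_(k+1)
     <= 2n, replacing [n] by X_(k+1) costs the term a ln 2. *)
  pose n := (hgt (z k.+1)).-1.
  have en : hgt (z k.+1) = n.+1 by rewrite /n prednK// (ltn_trans _ Nk1).
  move: Nk1; rewrite en ltnS => Nn.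
  have n0 : 0 < n%:R :> R by rewrite ltr0n (leq_trans _ Nn).
  have [w /andP[w0 wn] Lw] := Ha n (ltnW Nn).
  have [_ _ /(_ w)] := zmin k; rewrite en w0 ltnS wn => /(_ isT) Lk.
  have : ln `|zform c (z k)| <= ln (C * n%:R `^ (- a)).
    by rewrite ler_ln ?posrE ?mulr_gt0 ?powR_gt0//; exact: le_trans Lk Lw.
  rewrite lnM ?posrE ?powR_gt0// ln_powR => h; apply: le_trans h _.
  rewrite -addrA lerD2l mulNr -mulrN -mulrBr mulrN -mulrN ler_pM2l//.
  rewrite lerNl opprB lerBlDr -lnM ?posrE// ler_ln ?posrE// ?mulr_gt0//.
  by rewrite -natrM ler_nat muln2 -addnn -addn1 leq_add2l -(ltr0n R).
- move=> k Nk.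
  have Nz : (N0 < hgt (z k))%N by rewrite ltnW// ltnW// hN'.
  by rewrite -mulNr -ln_powR ler_ln ?posrE ?powR_gt0// Hb.
Qed.

(** * The function [psi] in terms of the form on Z^4 *)

Lemma dist_int_le (R : realType) (y : R) (k : int) : dist_int y <= `|y - k%:~R|.
Proof. by apply: ge_inf; [exists 0 => _ [m _ <-] | exists k]. Qed.

Lemma dist_int_ge0 (R : realType) (y : R) : 0 <= dist_int y.
Proof. by apply: lb_le_inf; [exists `|y - 0%:~R|; exists 0 | move=> _ [m _ <-]]. Qed.

Lemma dist_int_lt (R : realType) (y r : R) :
  dist_int y < r -> exists k : int, `|y - k%:~R| < r.
Proof.
move=> /inf_lt[]; first by exists `|y - 0%:~R|; exists 0.
by move=> _ [k _ <-] kr; exists k.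
Qed.

Lemma psi_le (R : realType) (Theta : 'rV[R]_3) (t : R) (x : 'cV[int]_3) :
  0 < height x -> (height x)%:~R <= t ->
  psi Theta t <= dist_int (linear_form Theta x).
Proof.
by move=> x0 xt; apply: ge_inf; [exists 0 => _ [y _ <-]; exact: dist_int_ge0 |
  exists x].
Qed.

Definition extended_form (R : realType) (Theta : 'rV[R]_3) : 'cV[R]_4 :=
  (row_mx (1%:M : 'M[R]_1) Theta)^T.

Definition lattice_point (k : int) (x : 'cV[int]_3) : 'rV[int]_4 :=
  row_mx (k%:M : 'M[int]_1) x^T.

Lemma zform_lattice_point (R : realType) (Theta : 'rV[R]_3) k x :
  zform (extended_form Theta) (lattice_point k x) =
  k%:~R + linear_form Theta x.
Proof.
rewrite /zform /lform /extended_form /emb /lattice_point /linear_form.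
rewrite (map_row_mx intr (k%:M : 'M[int]_1) x^T) tr_row_mx.
rewrite (mul_row_col (map_mx intr (k%:M : 'M[int]_1) : 'M[R]_1)
  (map_mx intr x^T) _ Theta^T) trmx1 mulmx1 [LHS]mxE.
congr (_ + _); first by rewrite !mxE eqxx.
by rewrite -map_trmx -trmx_mul mxE.
Qed.

Lemma hgt_lattice_point k x : (hgt (lattice_point k x))%:Z = height x.
Proof.
rewrite /hgt /height.
have e (i : 'I_3) : (absz (lattice_point k x 0%R (lift 0%R i)) : int) = `|x i 0|.
  rewrite (_ : lift 0 i = rshift 1 i); last exact: val_inj.
  by rewrite /lattice_point (row_mxEr (k%:M : 'M[int]_1) x^T) mxE abszE.
transitivity (\big[Num.max/0]_(i < 3)
    (absz (lattice_point k x 0%R (lift 0%R i)) : int)); last first.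
  by apply: eq_bigr.
apply: (big_morph (fun n : nat => n%:Z)) => // m n.
by case: (leqP m n) => mn; [rewrite max_r | rewrite max_l]; rewrite ?lez_nat// ltnW.
Qed.

Lemma lattice_pointP (w : 'rV[int]_4) : exists k x, w = lattice_point k x.
Proof.
exists (lsubmx (w : 'rV[int]_(1 + 3)) 0 0), (rsubmx (w : 'rV[int]_(1 + 3)))^T.
by rewrite /lattice_point trmxK -mx11_scalar hsubmxK.
Qed.

Lemma nonvanishing_extended (R : realType) (Theta : 'rV[R]_3) :
  lin_indep_int (row_mx (1%:M : 'M[R]_1) Theta) ->
  nonvanishing (extended_form Theta).
Proof.
move=> indep; split.
  rewrite /extended_form mxE (_ : 0 = lshift 3 0 :> 'I_(1 + 3)); last exact: val_inj.
  by rewrite (row_mxEl (1%:M : 'M[R]_1) Theta) mxE eqxx.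
move=> w w0; apply: trmx_inj; rewrite trmx0; apply: indep.
rewrite -w0 /linear_form /zform /lform /extended_form /emb -map_trmx.
by rewrite -[row_mx _ _ in LHS]trmxK -trmx_mul mxE.
Qed.

Lemma psi_upper (R : realType) (Theta : 'rV[R]_3) (a M t0 : R) :
  (forall t, t0 < t -> t `^ a * psi Theta t <= M) ->
  exists C N0, forall n, (N0 < n)%N -> exists2 w, (0 < hgt w <= n)%N &
    `|zform (extended_form Theta) w| <= C * n%:R `^ (- a).
Proof.
(* The slack 1 makes the inequality strict, so that the infima [psi] and [dist_int] supply an actual
   point and an actual integer. *)
move=> hM; exists (M + 1), (Num.truncn t0) => n Nn.
have n0 : (0 < n)%N by exact: leq_ltn_trans Nn.
have p0 : 0 < n%:R `^ a :> R by rewrite powR_gt0// ltr0n.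
have : psi Theta n%:R < (M + 1) * n%:R `^ (- a).
  rewrite powRN ltr_pdivlMr// mulrC; apply: le_lt_trans (hM _ _) _.
    by apply: lt_le_trans (truncnS_gt t0) _; rewrite ler_nat.
  by rewrite ltrDl.
move=> /inf_lt[].
  exists (dist_int (linear_form Theta (const_mx 1))); exists (const_mx 1) => //.
  have h1 : height (const_mx 1 : 'cV[int]_3) = 1.
    by rewrite /height !big_ord_recl big_ord0 !mxE.
  by rewrite /= h1; split=> //; rewrite ler1n.
move=> _ [x [x0 xn] <-] /dist_int_lt[k kx].
exists (lattice_point (- k) x).
  rewrite -(ltr_nat int) -(ler_nat int) !natz hgt_lattice_point x0 /=.
  by rewrite -(ler_int R).
by rewrite zform_lattice_point intrN addrC ltW.
Qed.

Lemma psi_lower (R : realType) (Theta : 'rV[R]_3) (b t0 : R) :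
  (forall t, t0 < t -> 1 <= t `^ b * psi Theta t) ->
  exists N0, forall w, (N0 < hgt w)%N ->
    (hgt w)%:R `^ (- b) <= `|zform (extended_form Theta) w|.
Proof.
move=> hM; exists (Num.truncn t0) => w Nw.
have h0 : (0 < hgt w)%N by exact: leq_ltn_trans Nw.
have p0 : 0 < (hgt w)%:R `^ b :> R by rewrite powR_gt0// ltr0n.
apply: le_trans (_ : psi Theta (hgt w)%:R <= _).
  rewrite powRN -[leLHS]mul1r ler_pdivrMr// mulrC; apply: hM.
  by apply: lt_le_trans (truncnS_gt t0) _; rewrite ler_nat.
have [k [x ew]] := lattice_pointP w; rewrite ew in h0 *.
apply: le_trans (_ : dist_int (linear_form Theta x) <= _).
  apply: psi_le; first by rewrite -(hgt_lattice_point k).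
  by rewrite -(hgt_lattice_point k).
apply: le_trans (dist_int_le _ (- k)) _.
by rewrite zform_lattice_point intrN opprK addrC.
Qed.

(** Pigeonhole: the fractional parts at the (n+1)^3 points with coordinates in 0..n fall into n^3
    intervals of length n^(-3), and [x] is the difference of two points sharing an interval. *)
Lemma dirichlet (R : realType) (Theta : 'rV[R]_3) (n : nat) : (0 < n)%N ->
  exists x : 'cV[int]_3, [/\ 0 < height x, height x <= n%:Z &
    dist_int (linear_form Theta x) * n%:R ^+ 3 <= 1].
Proof.
move=> n0; have n30 : (0 < n ^ 3)%N by rewrite expn_gt0 n0.
have n3R : 0 < n%:R ^+ 3 :> R by rewrite exprn_gt0// ltr0n.
pose vec (v : {ffun 'I_3 -> 'I_n.+1}) : 'cV[int]_3 := \col_i (v i)%:Z.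
pose fr v : R := linear_form Theta (vec v) -
  (Num.floor (linear_form Theta (vec v)))%:~R.
have fr0 v : 0 <= fr v by rewrite subr_ge0 floor_le.
have fr1 v : fr v < 1 by rewrite ltrBlDr addrC -intrD1 floorD1_gt.
pose box v : 'I_((n ^ 3).-1.+1) := inord (Num.truncn (fr v * n%:R ^+ 3)).
have boxE v : box v = Num.truncn (fr v * n%:R ^+ 3) :> nat.
  rewrite inordK// prednK// truncn_lt_nat; last by rewrite mulr_ge0// ltW.
  by rewrite natrX -[ltRHS]mul1r ltr_pM2r.
have /injectivePn[u [v uv buv]] : ~~ injectiveb box.
  apply/negP => /injectiveP/leq_card.
  by rewrite card_ffun !card_ord prednK// leqNgt ltn_exp2r// ltnSn.
pose x := vec u - vec v.
have xE i : x i 0 = (u i)%:Z - (v i)%:Z by rewrite !mxE.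
exists x; split.
- rewrite lt_neqAle; apply/andP; split; last first.
    by rewrite /height; elim/big_ind: _ => // a b; rewrite le_max => ->.
  apply/eqP => h; move/eqP: uv; apply; apply/ffunP => i.
  have : `|x i 0| <= height x by rewrite /height (bigD1 i)//= le_max lexx.
  by rewrite -h normr_le0 xE subr_eq0 eqz_nat => /eqP/val_inj.
- rewrite /height; elim/big_ind: _ => // [a b ? ?|i _]; first by rewrite ge_max; apply/andP.
  rewrite xE; have := ltn_ord (u i); have := ltn_ord (v i).
  by rewrite !ltnS ler_norml => ? ?; lia.
pose k := Num.floor (linear_form Theta (vec u)) -
  Num.floor (linear_form Theta (vec v)).
have Lx : linear_form Theta x - k%:~R = fr u - fr v.
  have -> : linear_form Theta x =
      linear_form Theta (vec u) - linear_form Theta (vec v).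
    by rewrite /linear_form /x map_mxB mulmxBr !mxE.
  by rewrite /k intrD mulrNz /fr; ring.
apply: le_trans (ler_wpM2r (ltW n3R) (dist_int_le _ k)) _.
rewrite Lx -{1}(gtr0_norm n3R) -normrM mulrBl.
have := truncn_itv (mulr_ge0 (fr0 u) (ltW n3R)).
have := truncn_itv (mulr_ge0 (fr0 v) (ltW n3R)).
rewrite -!boxE buv -natr1 ler_norml => /andP[? ?] /andP[? ?].
by apply/andP; split; lra.
Qed.

(** * Upper and lower limits, and the sets whose suprema are the exponents *)

Lemma limsup_bounded (R : realType) (f : R -> R) :
  (limf_esup (fun t => (f t)%:E) (pinfty_nbhs R) < +oo)%E ->
  exists M t0, forall t, t0 < t -> f t <= M.
Proof.
rewrite limf_esupE => /ereal_inf_lt[_ [V [t0 [_ Vt0]] <-]] Voo.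
have up t : t0 < t -> ((f t)%:E <= ereal_sup ((fun t => (f t)%:E) @` V))%E.
  by move=> tt0; apply: ereal_sup_ubound; exists t => //; exact: Vt0.
case: (ereal_sup _) up Voo => [M|//|] up _.
  by exists M, t0 => t /up; rewrite lee_fin.
by exists 0, t0 => t /up; rewrite leNgt ltNyr.
Qed.

Lemma bounded_limsup (R : realType) (f : R -> R) (M t0 : R) :
  (forall t, t0 < t -> f t <= M) ->
  (limf_esup (fun t => (f t)%:E) (pinfty_nbhs R) < +oo)%E.
Proof.
move=> hM; apply: (@le_lt_trans _ _ M%:E); last exact: ltry.
rewrite limf_esupE; apply: ge_ereal_inf.
exists (ereal_sup ((fun t => (f t)%:E) @` [set t | t0 < t]%classic)).
  exists [set t | t0 < t]%classic => //.
  by exists t0; split; [exact: num_real | move=> t].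
by apply: ge_ereal_sup => _ [t /hM tM <-]; rewrite lee_fin.
Qed.

Lemma liminf_infinite (R : realType) (f : R -> R) :
  ~ (limf_einf (fun t => (f t)%:E) (pinfty_nbhs R) < +oo)%E ->
  exists t0, forall t, t0 < t -> 1 <= f t.
Proof.
move=> /negP; rewrite -leNgt leye_eq => /eqP.
rewrite /limf_einf => /eqP; rewrite eqe_oppLR => /eqP h.
have : (limf_esup (\- (fun t => (f t)%:E)) (pinfty_nbhs R) < (-1)%:E)%E.
  by rewrite h ltNyr.
rewrite limf_esupE => /ereal_inf_lt[_ [V [t0 [_ Vt0]] <-]] V1.
exists t0 => t tt0; rewrite -lerN2 -lee_fin; apply: le_trans (ltW V1).
by apply: ereal_sup_ubound; exists t; [exact: Vt0 | rewrite /= EFinN].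
Qed.

Definition alpha_set (R : realType) (Theta : 'rV[R]_3) (gamma : R) : Prop :=
  (limf_esup (fun t : R => (t `^ gamma * psi Theta t)%:E) (pinfty_nbhs R)
    < +oo)%E.

Definition beta_set (R : realType) (Theta : 'rV[R]_3) (gamma : R) : Prop :=
  (limf_einf (fun t : R => (t `^ gamma * psi Theta t)%:E) (pinfty_nbhs R)
    < +oo)%E.

(** Dirichlet's bound at the integer part [n] of [t]; the constant 8 comes from t <= 2n. *)
Lemma alpha_set3 (R : realType) (Theta : 'rV[R]_3) : alpha_set Theta 3.
Proof.
apply: (@bounded_limsup R _ 8 1) => t t1.
have t0 : 0 < t by exact: lt_trans t1.
pose n := Num.truncn t.
have n0 : (0 < n)%N by rewrite truncn_gt0 ltW.
have nt : n%:R <= t by rewrite -truncn_ge_nat// ltW.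
have tn : t <= 2 * n%:R.
  apply: le_trans (ltW (truncnS_gt t)) _.
  by rewrite -natrM ler_nat -/n mul2n -addnn -addn1 leq_add2l.
have n0R : 0 < n%:R :> R by rewrite ltr0n.
have [x [x0 xn dx]] := dirichlet Theta n0.
have px : psi Theta t <= dist_int (linear_form Theta x).
  apply: psi_le => //; apply: le_trans nt.
  by rewrite -[leRHS]/(n%:Z%:~R) ler_int.
rewrite (_ : t `^ 3 = t ^+ 3); last by rewrite -powR_mulrn// ltW.
have d0 := dist_int_ge0 (linear_form Theta x).
apply: le_trans (ler_wpM2l (exprn_ge0 _ (ltW t0)) px) _.
have t3 : t ^+ 3 <= 8 * n%:R ^+ 3.
  have -> : 8 * n%:R ^+ 3 = (2 * n%:R) ^+ 3 :> R by ring.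
  by apply: lerXn2r => //; rewrite nnegrE ?mulr_ge0// ltW.
apply: le_trans (ler_wpM2r d0 t3) _.
by rewrite -mulrA ler_piMr// mulrC.
Qed.

Lemma alpha_beta_sets (R : realType) (Theta : 'rV[R]_3) (a b : R) :
  lin_indep_int (row_mx (1%:M : 'M[R]_1) Theta) ->
  1 < a -> 0 <= b -> alpha_set Theta a -> ~ beta_set Theta b ->
  a - 1 <= b / a + (b / a) ^+ 2.
Proof.
move=> indep a1 b0 /limsup_bounded[M [t0 /psi_upper[C [N hN]]]].
move=> /liminf_infinite[t1 /psi_lower[N' hN']].
apply: (exponent_inequality (c := extended_form Theta) (C := C) (N0 := maxn N N')) => //.
- exact: nonvanishing_extended.
- by move=> n nN; apply: hN; apply: leq_ltn_trans nN; exact: leq_maxl.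
- by move=> w wN; apply: hN'; apply: leq_ltn_trans wN; exact: leq_maxr.
Qed.

(** * Real inequalities for [g2] *)

(** With u = 1/r and [s] the square root, the claim reduces to u s <= 1/2 - u^2. After squaring this
    is (1 - 3u)(1 - u) >= 0, which is where r >= 3 enters. *)
Lemma g2_root_le (R : realType) (r : R) : 3 <= r ->
  0 < g2 r /\ g2 r + g2 r ^+ 2 <= r - 1.
Proof.
move=> r3; rewrite /g2; set u := 1 / r; have r0 : 0 < r by lra.
have u0 : 0 < u by rewrite divr_gt0.
have ru : r * u = 1 by rewrite /u mul1r divff// gt_eqF.
have u3 : u <= 1 / 3 by nra.
have -> : 1 / r ^+ 2 = u ^+ 2 by rewrite /u expr_div_n expr1n.
set s := Num.sqrt _.
have s2 : s ^+ 2 = r + u ^+ 2 - 7 / 4.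
  by rewrite sqr_sqrtr//; have := sqr_ge0 u; lra.
have s0 : 0 <= s by exact: sqrtr_ge0.
have s1 : 1 <= s.
  rewrite -(ler_pXn2r (n := 2)) ?nnegrE// expr1n s2.
  by have := sqr_ge0 u; lra.
split; first by lra.
have us : u * s <= 1 / 2 - u ^+ 2.
  rewrite -(ler_pXn2r (n := 2)) ?nnegrE//; last 2 first.
  - by rewrite mulr_ge0// ltW.
  - by nra.
  rewrite exprMn s2.
  have -> : u ^+ 2 * (r + u ^+ 2 - 7 / 4) =
      u * (r * u) + u ^+ 4 - 7 / 4 * u ^+ 2 by ring.
  rewrite ru mulr1.
  have : 0 <= (1 - 3 * u) * (1 - u) by rewrite mulr_ge0; lra.
  have -> : (1 / 2 - u ^+ 2) ^+ 2 = 1 / 4 - u ^+ 2 + u ^+ 4 by field.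
  by lra.
have -> : s + u - 1 / 2 + (s + u - 1 / 2) ^+ 2 =
  s ^+ 2 + u ^+ 2 + 2 * (u * s) - 1 / 4 by field.
by rewrite s2; lra.
Qed.

(** Continuity in [a]: the supremum alpha may not be attained, so the contradiction has to persist
    slightly below it. *)
Lemma mul_lt_approx (R : realType) (r b : R) : 3 <= r -> 0 <= b ->
  b < r * g2 r ->
  exists2 e, 0 < e & forall a, r - e < a <= r ->
    1 < a /\ b / a + (b / a) ^+ 2 < a - 1.
Proof.
move=> r3 b0 br; have [g0 gr] := g2_root_le r3.
have r0 : 0 < r by lra.
(* This is r^2 times the gap (r - 1) - b/r - (b/r)^2. Below [r] the term a^2 (a - 1) drops by at
   most 3 r^2 (r - a), whence the choice of [e]. *)
pose d := r ^+ 2 * (r - 1) - b * r - b ^+ 2.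
have d0 : 0 < d.
  have h1 : b ^+ 2 < (r * g2 r) ^+ 2.
    by rewrite ltrXn2r// nnegrE mulr_ge0// ltW.
  have h2 : b * r < r * g2 r * r by rewrite ltr_pM2r.
  have := ler_wpM2l (exprn_ge0 2 (ltW r0)) gr.
  by rewrite /d; lra.
have r20 : 0 < 3 * r ^+ 2 by rewrite mulr_gt0// exprn_gt0.
exists (Num.min 1 (d / (3 * r ^+ 2))); first by rewrite lt_min ltr01 divr_gt0.
move=> a /andP[]; rewrite ltrBlDl -ltrBlDr lt_min => /andP[a1 ad] ar.
have a2 : 1 < a by lra.
split=> //; have a0 : 0 < a by lra.
have a20 : 0 < a ^+ 2 by rewrite exprn_gt0.
rewrite -(ltr_pM2l a20) mulrDr -exprMn.
have -> : a ^+ 2 * (b / a) = a * b by field; rewrite gt_eqF.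
have -> : a * (b / a) = b by field; rewrite gt_eqF.
move: ad; rewrite ltr_pdivlMr// => ad.
have e1 : r ^+ 2 * (r - 1) - a ^+ 2 * (a - 1) =
    (r - a) * (r ^+ 2 + r * a + a ^+ 2 - r - a) by ring.
have e2 : (r - a) * (r ^+ 2 + r * a + a ^+ 2 - r - a) <= (r - a) * (3 * r ^+ 2).
  by apply: ler_wpM2l; nra.
have e3 : a * b <= b * r by rewrite mulrC ler_wpM2l.
by move: ad; rewrite /d; lra.
Qed.

(** * Passage to the suprema, for finite and infinite alpha *)

Theorem theorem24 (R : realType) (Theta : 'rV[R]_3)
  (hindep : lin_indep_int (row_mx (1%:M : 'M[R]_1) Theta)) :
  (alpha Theta * g2_ext (alpha Theta) <= beta Theta)%E.
Proof.
have notb b : (beta Theta < b%:E)%E -> ~ beta_set Theta b.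
  move=> + bb; rewrite ltNge => /negP; apply.
  by apply: ereal_sup_ubound; exists b.
have lea a : alpha_set Theta a -> (a%:E <= alpha Theta)%E.
  by move=> aa; apply: ereal_sup_ubound; exists a.
have a3 := lea _ (alpha_set3 Theta).
have key a b : 1 < a -> 0 <= b -> alpha_set Theta a -> (beta Theta < b%:E)%E ->
    a - 1 <= b / a + (b / a) ^+ 2.
  by move=> *; apply: (alpha_beta_sets hindep) => //; exact: notb.
have apx x : (x%:E < alpha Theta)%E -> exists2 a, alpha_set Theta a & x < a.
  move=> /ereal_sup_gt[_ [a aa <-]]; rewrite lte_fin => xa.
  by exists a.
rewrite leNgt; apply/negP; move: a3 lea apx.
case: (alpha Theta) => [r| |]; rewrite ?leeNy_eq //= => a3 lea apx.
- rewrite -EFinM => hb; rewrite lee_fin in a3.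
  have [g0 _] := g2_root_le a3.
  have rg0 : 0 < r * g2 r by rewrite mulr_gt0//; lra.
  (* A nonnegative real strictly between beta and r g2(r); the maximum with 0 and the witness 0
     cover negative and infinite beta. *)
  have [b [b0 brg bb]] : exists b, [/\ 0 <= b, b < r * g2 r & (beta Theta < b%:E)%E].
    move: hb; case: (beta Theta) => [s| |]//.
      rewrite lte_fin => hs; exists ((Num.max s 0 + r * g2 r) / 2).
      rewrite lte_fin; have [s0|s0] := leP s 0; split; lra.
    by exists 0; rewrite ltNyr.
  have [e e0 he] := mul_lt_approx a3 b0 brg.
  have [|a aa ra] := apx (r - e); first by rewrite lte_fin; lra.
  have ar := lea a aa; rewrite lee_fin in ar.
  have [|a1 hlt] := he a; first by rewrite ra.
  by have := key a b a1 b0 aa bb; rewrite leNgt hlt.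
- move=> hb.
  have [b [b0 bb]] : exists b, 0 <= b /\ (beta Theta < b%:E)%E.
    move: hb; rewrite mulyy; case: (beta Theta) => [s| |]// _.
      by exists (Num.max s 0 + 1); rewrite lte_fin; have [s0|s0] := leP s 0; split; lra.
    by exists 0; rewrite ltNyr.
  (* With alpha infinite, [a] can exceed b + b^2 + 1; since b/a <= b, the inequality of [key]
     fails. *)
  have [|a aa ha] := apx (b + b ^+ 2 + 1); first exact: ltry.
  have b2 := sqr_ge0 b; have a1 : 1 < a by lra.
  have := key a b a1 b0 aa bb; rewrite leNgt => /negP; apply.
  have ba : b / a <= b by rewrite ler_pdivrMr ?(lt_trans _ a1)// ler_peMr// ltW.
  have ba0 : 0 <= b / a by rewrite divr_ge0//; lra.
  by nra.
Qed.
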